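(* Suppose that $F^\epsilon$ is continuous on $\mathbb{R}$. Suppose there exist a non-singular positive-definite $d\times d$ matrix $\Gamma$ and some $c\in[0,\infty)$ such that $\|\beta\|_{2,\Gamma}=c$ for all $\beta\in\mathcal{B}_0$. If $\|\hat\beta_n\|_2=O_{\mathbb{P}}(1)$, then $$\|\hat\beta_n\|_{2,\Gamma}\stackrel{\mathbb{P}}{\longrightarrow}c\quad\text{as } n\to\infty.$$
   Context: Let $d\ge 1$, let $X$ be a random vector in $\mathbb{R}^d$ with a continuous distribution, $\epsilon$ a real random variable (noise) with known cumulative distribution function $F^\epsilon$, independent of $X$, $\beta_0\in\mathbb{R}^d$ deterministic, and $Y$ a real random variable with $Y\stackrel{d}{=}\beta_0^TX+\epsilon$, i.e. $F^Y=F^{\beta_0^TX}\star F^\epsilon$, where $F^Z$ denotes the cumulative distribution function of $Z$ and $[F^{\beta^TX}\star F^\epsilon](y)=\int F^\epsilon(y-\beta^Tx)\,dF^X(x)$. One observes two independent samples: $Y_1,\dots,Y_n$ i.i.d. distributed as $Y$, and $X_1,\dots,X_n$ i.i.d. distributed as $X$. Let $F^Y_n(y)=n^{-1}\sum_{i=1}^n\mathbf{1}\{Y_i\le y\}$ and $$\mathbb{D}_{n,2}(\beta)=\int\Big(F^Y_n(y)-n^{-1}\sum_{i=1}^nF^\epsilon(y-\beta^TX_i)\Big)^2dF^Y_n(y).$$ The deconvolution least squares estimator (DLSE) $\hat\beta_n$ is any vector minimizing $\mathbb{D}_{n,2}$ over $\mathbb{R}^d$. $\mathcal{B}_0=\{\beta\in\mathbb{R}^d: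 F^Y=F^{\beta^TX}\star F^\epsilon\}$ is the set of all regression vectors for which the model holds. $\|\cdot\|_2$ is the Euclidean norm and, for a positive-definite matrix $\Gamma$, $\|x\|_{2,\Gamma}=\sqrt{x^T\Gamma x}$. *)

(* Defs.v *)
From HB Require Import structures.
From mathcomp Require Import all_boot all_order all_algebra.
From mathcomp Require Import all_classical all_reals all_analysis.

Set Implicit Arguments.
Unset Strict Implicit.
Unset Printing Implicit Defensive.

Import Order.TTheory GRing.Theory Num.Theory.
Import numFieldNormedType.Exports.

Local Open Scope classical_set_scope.
Local Open Scope ring_scope.

(* Vectors of R^k are k-tuples: the library equips this type with the product
   sigma-algebra, i.e. the Borel sets of R^k. *)
Definition colv (R : realType) (k : nat) (x : k.-tuple R) : 'cV[R]_k :=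
  \col_i tnth x i.

Definition dotp (R : realType) (k : nat) (b x : k.-tuple R) : R :=
  ((colv b)^T *m colv x) 0 0.

Definition norm2 (R : realType) (k : nat) (x : k.-tuple R) : R :=
  Num.sqrt (dotp x x).

(* Symmetry is not required: only the quadratic form of G matters here. *)
Definition posdef (R : realType) (k : nat) (G : 'M[R]_k) : Prop :=
  forall x : 'cV[R]_k, x != 0 -> 0 < (x^T *m G *m x) 0 0.

Definition normG (R : realType) (k : nat) (G : 'M[R]_k) (x : k.-tuple R) : R :=
  Num.sqrt (((colv x)^T *m G *m colv x) 0 0).

(* Equality in distribution. The laws are compared on measurable sets only:
   the library's pushforward is a function of arbitrary sets. *)
Definition same_law d d' (T : measurableType d) (T' : measurableType d')
    (R : realType) (P : probability T R) (U V : T -> T') : Prop :=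
  forall A : set T', measurable A -> P (U @^-1` A) = P (V @^-1` A).

Definition indep2 d d1 d2 (T : measurableType d) (T1 : measurableType d1)
    (T2 : measurableType d2) (R : realType) (P : probability T R)
    (U : T -> T1) (V : T -> T2) : Prop :=
  forall (A : set T1) (B : set T2), measurable A -> measurable B ->
    P (U @^-1` A `&` V @^-1` B) = (P (U @^-1` A) * P (V @^-1` B))%E.

Definition mutual_indep d (T : measurableType d) (R : realType)
    (P : probability T R) (I : eqType) (S : I -> set (set T)) : Prop :=
  forall (J : seq I) (A : I -> set T), uniq J ->
    (forall i, i \in J -> S i (A i)) ->
    P (\bigcap_(i in [set` J]) A i) = (\prod_(i <- J) P (A i))%E.

(* Sigma-algebras generated by the variables of two sequences, listed as one
   family; its mutual independence says that each sequence is independent and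
   that the two sequences are independent of each other. *)
Definition joint_sigma d d1 d2 (T : measurableType d) (T1 : measurableType d1)
    (T2 : measurableType d2) (U : nat -> T -> T1) (V : nat -> T -> T2)
    (k : nat + nat) : set (set T) :=
  match k with
  | inl i => preimage_set_system setT (U i) measurable
  | inr i => preimage_set_system setT (V i) measurable
  end.

Definition atomless_law d d' (T : measurableType d) (T' : measurableType d')
    (R : realType) (P : probability T R) (U : {RV P >-> T'}) : Prop :=
  forall x : T', distribution P U [set x] = 0%E.

Definition cdfR d (T : measurableType d) (R : realType) (P : probability T R)
    (Z : {RV P >-> R}) (y : R) : R := fine (cdf Z y).

(* [F^{b^T X} * F](y), the integral being against the law of X. *)
Definition conv_cdf d (T : measurableType d) (R : realType) (P : probability T R)
    (k : nat) (X : {RV P >-> k.-tuple R}) (F : R -> R) (b : k.-tuple R)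
    (y : R) : R :=
  \int[distribution P X]_x F (y - dotp b x).

Definition B0 d (T : measurableType d) (R : realType) (P : probability T R)
    (k : nat) (X : {RV P >-> k.-tuple R}) (eps Y : {RV P >-> R}) :
    set (k.-tuple R) :=
  [set b | forall y : R, cdfR Y y = conv_cdf X (cdfR eps) b y].

Definition emp_cdf (R : realType) (n : nat) (ys : nat -> R) (y : R) : R :=
  n%:R^-1 * \sum_(i < n) (ys i <= y)%R%:R.

Definition emp_measure (R : realType) (n : nat) (ys : nat -> R) :
    {measure set R -> \bar R} :=
  mscale (n%:R^-1)%:nng (msum (fun i => \d_(ys i)) n).

Definition Dn2 (R : realType) (k n : nat) (F : R -> R) (ys : nat -> R)
    (xs : nat -> k.-tuple R) (b : k.-tuple R) : R :=
  \int[emp_measure n ys]_y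
    (emp_cdf n ys y - n%:R^-1 * \sum_(i < n) F (y - dotp b (xs i))) ^+ 2.

Definition is_dlse (R : realType) (k n : nat) (F : R -> R) (ys : nat -> R)
    (xs : nat -> k.-tuple R) (b : k.-tuple R) : Prop :=
  forall b' : k.-tuple R, Dn2 n F ys xs b <= Dn2 n F ys xs b'.

Definition bounded_in_prob d (T : measurableType d) (R : realType)
    (P : probability T R) (Z : nat -> T -> R) : Prop :=
  forall e : R, 0 < e -> exists K : R,
    \forall n \near \oo, (P [set w | (K < `|Z n w|)%R] < e%:E)%E.

Definition cvg_in_prob d (T : measurableType d) (R : realType)
    (P : probability T R) (Z : nat -> T -> R) (c : R) : Prop :=
  forall e : R, 0 < e ->
    P [set w | e < `|Z n w - c|] @[n --> \oo] --> 0%E.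

(* Main.v *)
(** Write F for the c.d.f. of eps, G_b for the c.d.f. of b^T X + eps, and let
    F_n and G_(n,b) be the empirical counterparts entering D_(n,2)(b).  All
    convergences are in probability and only use the weak law of large numbers.

    At beta0 both F_n and G_(n,beta0) converge pointwise, hence uniformly by
    Pólya's theorem, to the continuous c.d.f. F^Y, so D_(n,2)(beta0) -> 0.
    If b is not in B_0, then F^Y and G_b differ at some point; as F^Y is
    continuous and both functions are monotone, they differ by at least some
    t > 0 on a whole interval ]u, v] to which the law of Y gives mass at least t.
    F is uniformly continuous and the law of X is tight, so G_(n,b') at u and v
    is close to G_b for all b' in a neighbourhood of b, which bounds
    D_(n,2)(b') away from 0 there.  Compactness makes this uniform over the b'
    with bounded norm and |‖b'‖_Gamma - c| > e; hence betahat_n, which does at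
    least as well as beta0, avoids them with probability tending to 1. *)
Require Import Defs.
From HB Require Import structures.
From mathcomp Require Import all_boot all_order all_algebra.
From mathcomp Require Import all_classical all_reals all_analysis.
From mathcomp Require Import measurable_realfun.
From mathcomp Require Import ring lra.

Set Implicit Arguments.
Unset Strict Implicit.
Unset Printing Implicit Defensive.

Import Order.TTheory GRing.Theory Num.Theory.
Import numFieldNormedType.Exports.

Local Open Scope classical_set_scope.
Local Open Scope ring_scope.

(** * Measurability of comparisons between random variables *)

Section measurable_comparison.
Context d (T : measurableType d) (R : realType) (f g : T -> R).
Hypotheses (mf : measurable_fun setT f) (mg : measurable_fun setT g).

Lemma measurable_ler_set : measurable [set w | f w <= g w].
Proof. by rewrite -[X in measurable X]setTI; exact: measurable_fun_le. Qed.

Lemma measurable_ltr_set : measurable [set w | f w < g w].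
Proof.
rewrite -[X in measurable X]setTI.
by apply: (measurable_fun_ltr mf mg measurableT (Y := [set true])).
Qed.

Lemma measurable_ler_nat : measurable_fun setT (fun w => (f w <= g w)%R%:R : R).
Proof.
rewrite (_ : (fun w => _) = \1_[set w | f w <= g w]).
  exact: measurable_indic measurable_ler_set.
apply/funext => w; rewrite indicE; congr (nat_of_bool _)%:R.
by apply/idP/idP; rewrite inE.
Qed.

End measurable_comparison.

(** * Expectations of bounded random variables *)

Section bounded_expectation.
Context d (T : measurableType d) (R : realType) (P : probability T R).

Lemma bounded_integrable (f : T -> R) (M : R) : measurable_fun setT f ->
  (forall w, `|f w| <= M) -> P.-integrable setT (EFin \o f).
Proof.
move=> mf fM; apply: measurable_bounded_integrable => //.
  by rewrite (le_lt_trans (probability_le1 P measurableT))// ltry.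
exists M; split; first exact: num_real.
by move=> N MN w _ /=; exact: le_trans (fM w) (ltW MN).
Qed.

Lemma Rintegral_sum (I : eqType) (s : seq I) (f : I -> T -> R) :
  (forall i, P.-integrable setT (EFin \o f i)) ->
  \int[P]_w (\sum_(i <- s) f i w) = \sum_(i <- s) \int[P]_w f i w.
Proof.
move=> If; rewrite /Rintegral.
under eq_integral do rewrite -sumEFin.
rewrite integral_sum//=.
by rewrite sum_fine//= => i _; apply: integrable_fin_num; last exact: If.
Qed.

Lemma Rintegral_indic (A : set T) : measurable A ->
  \int[P]_w \1_A w = fine (P A).
Proof. by move=> mA; rewrite /Rintegral integral_indic// setIT. Qed.

(** Integrate the pointwise bound of [e ^+ 2] times the indicator of [e <= |f|] by [f ^+ 2]. The
    bound [M] supplies integrability. *)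
Lemma markov_sqr (f : T -> R) (M e : R) : measurable_fun setT f ->
  (forall w, `|f w| <= M) -> 0 < e ->
  (P [set w | (e <= `|f w|)%R] <= (e ^- 2 * \int[P]_w (f w ^+ 2))%:E)%E.
Proof.
move=> mf fM e0.
have mA : measurable [set w | e <= `|f w|].
  by apply: measurable_ler_set => //; exact: measurableT_comp.
have If2 : P.-integrable setT (EFin \o (fun w => f w ^+ 2)).
  apply: (@bounded_integrable _ (M ^+ 2)); first exact: measurable_funX.
  move=> w; rewrite normrX lerXn2r// nnegrE//.
  exact: le_trans (fM w).
have IA : P.-integrable setT (EFin \o (fun w => e ^+ 2 * \1_[set w | e <= `|f w|] w)).
  apply: (@bounded_integrable _ (e ^+ 2)).
    by apply: measurable_funM => //; exact: measurable_indic.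
  move=> w; rewrite normrM ger0_norm ?sqr_ge0// indicE.
  by case: (_ \in _); rewrite ?normr1 ?normr0 ?mulr1 ?mulr0 ?sqr_ge0.
rewrite -[leLHS]fineK ?fin_num_measure// lee_fin ler_pdivlMl ?exprn_gt0//.
rewrite -Rintegral_indic// -RintegralZl//; last first.
  apply: (@bounded_integrable _ 1); first exact: measurable_indic.
  by move=> w; rewrite indicE; case: (_ \in _); rewrite ?normr1 ?normr0.
apply: le_Rintegral => // w _; rewrite indicE.
have [/set_mem/= efw|_] := boolP (_ \in _); last by rewrite mulr0 sqr_ge0.
by rewrite mulr1 -[leRHS]real_normK ?num_real// lerXn2r// nnegrE ltW.
Qed.

Lemma Rintegral_cst_prob (c : R) : \int[P]_w c = c.
Proof.
rewrite Rintegral_cst//; transitivity (c * fine (P [set: T])) => //.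
by rewrite probability_setT mulr1.
Qed.

End bounded_expectation.

(** * Independence and product measures *)

Section independence.
Context d d1 d2 (T : measurableType d) (T1 : measurableType d1)
  (T2 : measurableType d2) (R : realType) (P : probability T R).

(** The law of the pair and the product of the laws agree on measurable rectangles, hence everywhere
    by uniqueness of the product measure. *)
Lemma indep2_law_pair (U : {RV P >-> T1}) (V : {RV P >-> T2}) : indep2 P U V ->
  forall A : set (T1 * T2), measurable A ->
    (distribution P U \x distribution P V)%E A = P ((fun w => (U w, V w)) @^-1` A).
Proof.
move=> UV A mA.
have mUV : measurable_fun setT (fun w => (U w, V w)).
  by apply: measurable_fun_pair.
pose W : {mfun T >-> (T1 * T2)%type} := mfun_Sub (mem_set mUV).
apply: (@product_measure_unique _ _ _ _ _ _ _ (distribution P W)) => //.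
Qed.

End independence.

Lemma indep2_comp d d1 d2 d3 d4 (T : measurableType d) (T1 : measurableType d1)
    (T2 : measurableType d2) (T3 : measurableType d3) (T4 : measurableType d4)
    (R : realType) (P : probability T R) (U : T -> T1) (V : T -> T2)
    (f : T1 -> T3) (g : T2 -> T4) :
  measurable_fun setT f -> measurable_fun setT g ->
  indep2 P U V -> indep2 P (f \o U) (g \o V).
Proof.
move=> mf mg UV A B mA mB.
apply: (UV (f @^-1` A) (g @^-1` B)).
  by rewrite -[X in measurable X]setTI; exact: mf.
by rewrite -[X in measurable X]setTI; exact: mg.
Qed.

(** Tonelli's theorem for the joint law, which is a product. Tonelli asks for a nonnegative
    integrand on the whole plane, while [U] and [V] are nonnegative only as functions on [T]; hence
    the absolute values in the integrand. *)
Lemma indep2_expectationM d (T : measurableType d) (R : realType)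
    (P : probability T R) (U V : T -> R) :
  measurable_fun setT U -> measurable_fun setT V ->
  (forall w, 0 <= U w <= 1) -> (forall w, 0 <= V w <= 1) ->
  indep2 P U V ->
  \int[P]_w (U w * V w) = \int[P]_w U w * \int[P]_w V w.
Proof.
move=> mU mV U01 V01 UV.
have absU w : `|U w| = U w by have /andP[? _] := U01 w; rewrite ger0_norm.
have absV w : `|V w| = V w by have /andP[? _] := V01 w; rewrite ger0_norm.
have IU : P.-integrable setT (EFin \o U).
  by apply: (@bounded_integrable _ _ _ _ _ 1) => // w; rewrite absU; have /andP[] := U01 w.
have IV : P.-integrable setT (EFin \o V).
  by apply: (@bounded_integrable _ _ _ _ _ 1) => // w; rewrite absV; have /andP[] := V01 w.
rewrite /Rintegral -fineM; [|exact: integrable_fin_num..].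
congr fine.
pose U' : {RV P >-> R} := mfun_Sub (mem_set mU).
pose V' : {RV P >-> R} := mfun_Sub (mem_set mV).
have mUV : measurable_fun setT (fun w => (U w, V w)) by exact: measurable_fun_pair.
pose W : {RV P >-> (R * R)%type} := mfun_Sub (mem_set mUV).
have mn : measurable_fun setT (fun x : R => `|x|%:E) by apply/measurable_EFinP.
have mh : measurable_fun setT (fun z : R * R => (`|z.1| * `|z.2|)%:E).
  apply/measurable_EFinP; apply: measurable_funM; apply: measurableT_comp => //.
transitivity (\int[distribution P W]_z (`|z.1| * `|z.2|)%:E)%E.
  rewrite ge0_integral_distribution//.
  by apply: eq_integral => w _ /=; rewrite absU absV.
transitivity (\int[(distribution P U' \x distribution P V')]_z (`|z.1| * `|z.2|)%:E)%E.
  apply: eq_measure_integral => A mA _; apply/esym.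
  exact: (@indep2_law_pair _ _ _ _ _ _ _ P U' V').
rewrite fubini_tonelli1//.
rewrite /fubini_F/=.
under eq_integral => x _.
  under eq_integral do rewrite EFinM.
  rewrite ge0_integralZl//.
  over.
rewrite ge0_integralZr//; last exact: integral_ge0.
rewrite !ge0_integral_distribution//.
by congr (_ * _)%E; apply: eq_integral => w _ /=; rewrite ?absU ?absV.
Qed.

(** * Weak law of large numbers for variables with values in [0, 1] *)

Section weak_law.
Context d (T : measurableType d) (R : realType) (P : probability T R).

(** Chebyshev's inequality: once the variables are centred, pairwise independence kills the cross
    terms, and each of the [n.+1] diagonal terms is at most 1, so the variance of the mean is at
    most [n.+1%:R^-1]. *)
Lemma weak_law_bound (U : nat -> T -> R) (m : R) (n : nat) (e : R) :
  (forall i, measurable_fun setT (U i)) -> (forall i w, 0 <= U i w <= 1) ->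
  (forall i, \int[P]_w U i w = m) ->
  (forall i j, i != j -> indep2 P (U i) (U j)) -> 0 < e ->
  (P [set w | (e <= `|n.+1%:R^-1 * (\sum_(i < n.+1) U i w) - m|)%R]
    <= ((e ^+ 2 * n.+1%:R)^-1)%:E)%E.
Proof.
move=> mU U01 Um UU e0.
have absU i w : `|U i w| = U i w by have /andP[? _] := U01 i w; rewrite ger0_norm.
have IU i : P.-integrable setT (EFin \o U i).
  by apply: (@bounded_integrable _ _ _ _ _ 1) => // w; rewrite absU; have /andP[] := U01 i w.
(* With [m] in [0, 1], the centred variables [V i] are bounded by 1 in absolute value. *)
have m01 : 0 <= m <= 1.
  rewrite -(Um 0%N); apply/andP; split.
    by apply: Rintegral_ge0 => w _; have /andP[] := U01 0%N w.
  rewrite -(Rintegral_cst_prob P 1).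
  apply: le_Rintegral => //; last by move=> w _; have /andP[] := U01 0%N w.
  by apply: (@bounded_integrable _ _ _ _ _ 1) => // w; rewrite normr1.
pose V i w := U i w - m.
have V1 i w : `|V i w| <= 1.
  by rewrite /V ler_norml; have := U01 i w; lra.
have mV i : measurable_fun setT (V i) by apply: measurable_funB.
have IVV i j : P.-integrable setT (EFin \o (fun w => V i w * V j w)).
  apply: (@bounded_integrable _ _ _ _ _ 1); first exact: measurable_funM.
  by move=> w; rewrite normrM mulr_ile1.
have EVV i j : i != j -> \int[P]_w (V i w * V j w) = 0.
  move=> ij.
  have IUU : P.-integrable setT (EFin \o (fun w => U i w * U j w)).
    apply: (@bounded_integrable _ _ _ _ _ 1); first exact: measurable_funM.
    move=> w; rewrite normrM !absU; have := U01 i w; have := U01 j w.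
    by move=> /andP[? ?] /andP[? ?]; rewrite mulr_ile1.
  have IL : P.-integrable setT (EFin \o (fun w => m * (U i w + U j w))).
    apply: (@bounded_integrable _ _ _ _ _ 2).
      by apply: measurable_funM => //; exact: measurable_funD.
    move=> w; rewrite normrM; have := U01 i w; have := U01 j w => *.
    rewrite !ger0_norm; [nra|lra|lra].
  have Im : P.-integrable setT (EFin \o (fun w => m ^+ 2 : R)).
    by apply: (@bounded_integrable _ _ _ _ _ `|m ^+ 2|) => //.
  transitivity (\int[P]_w ((U i w * U j w - m * (U i w + U j w)) + m ^+ 2)).
    by apply: eq_Rintegral => w _; rewrite /V; ring.
  rewrite RintegralD//; last first.
    by have := @integrableB _ _ _ P setT measurableT _ _ IUU IL.
  rewrite RintegralB// RintegralZl//; last first.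
    by have := @integrableD _ _ _ P setT measurableT _ _ (IU i) (IU j).
  rewrite RintegralD// !Um Rintegral_cst_prob.
  rewrite indep2_expectationM// ?Um; [ring|exact: UU].
pose S w := n.+1%:R^-1 * (\sum_(i < n.+1) U i w) - m.
have SE w : S w = n.+1%:R^-1 * \sum_(i < n.+1) V i w.
  rewrite /S /V sumrB mulrBr sumr_const card_ord -[X in _ - _ * X]mulr_natl.
  by rewrite mulrA mulVf ?pnatr_eq0// mul1r.
have mS : measurable_fun setT S.
  apply: measurable_funB => //; apply: measurable_funM => //.
  by apply: measurable_sum => i; exact: mU.
have S1 w : `|S w| <= 1.
  rewrite SE normrM ger0_norm ?invr_ge0// ler_pdivrMl ?ltr0n// mulr1.
  apply: (le_trans (ler_norm_sum _ _ _)).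
  apply: (@le_trans _ _ (\sum_(i < n.+1) 1)); first by apply: ler_sum => i _.
  by rewrite sumr_const card_ord.
apply: (le_trans (markov_sqr P mS S1 e0)).
rewrite lee_fin [leRHS]invfM ler_wpM2l ?invr_ge0 ?exprn_ge0 ?(ltW e0)//.
have -> : \int[P]_w (S w ^+ 2) =
   n.+1%:R^-1 ^+ 2 * \sum_(i < n.+1) \sum_(j < n.+1) \int[P]_w (V i w * V j w).
  transitivity (\int[P]_w (n.+1%:R^-1 ^+ 2 *
      \sum_(i < n.+1) \sum_(j < n.+1) (V i w * V j w))).
    apply: eq_Rintegral => w _; rewrite SE exprMn; congr (_ * _).
    by rewrite expr2 big_distrlr.
  have I1 (i : 'I_n.+1) : P.-integrable setT
      (EFin \o (fun w => \sum_(j < n.+1) (V i w * V j w))).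
    have := @integrable_sum _ _ _ P setT measurableT _ (index_enum 'I_n.+1) predT
      (fun j w => (V i w * V j w)%:E) (fun j _ => IVV i j).
    by apply: eq_integrable => // w _; rewrite sumEFin.
  rewrite RintegralZl//; last first.
    have := @integrable_sum _ _ _ P setT measurableT _ (index_enum 'I_n.+1) predT
      (fun (i : 'I_n.+1) w => (\sum_(j < n.+1) (V i w * V j w))%:E) (fun i _ => I1 i).
    by apply: eq_integrable => // w _; rewrite sumEFin.
  rewrite Rintegral_sum//; congr (_ * _); apply: eq_bigr => i _.
  by rewrite Rintegral_sum.
rewrite expr2 -mulrA -[leRHS]mulr1 ler_wpM2l ?invr_ge0//.
rewrite ler_pdivrMl ?ltr0n// mulr1.
apply: (@le_trans _ _ (\sum_(i < n.+1) 1)); last by rewrite sumr_const card_ord.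
(* In row [i] of the double sum only the diagonal entry survives. *)
apply: ler_sum => i _; rewrite (bigD1 i)//= big1 ?addr0; last first.
  by move=> j ji; apply: EVV; rewrite eq_sym.
rewrite -(Rintegral_cst_prob P 1).
apply: le_Rintegral => //.
  by apply: (@bounded_integrable _ _ _ _ _ 1) => // w; rewrite normr1.
move=> w _; apply: (le_trans (ler_norm _)).
by rewrite normrM mulr_ile1.
Qed.

End weak_law.

(** * The filter of events whose probability tends to 1 *)

Section with_high_probability.
Context d (T : measurableType d) (R : realType) (P : probability T R).

(* The sets of pairs (sample size, outcome) which contain, for each sample size
   [n], an event [W n] with probability tending to 1. *)
Definition whp : set_system (nat * T) := [set S | exists W : nat -> set T,
  [/\ forall n, measurable (W n), forall n w, W n w -> S (n, w)
    & P (~` W n) @[n --> \oo] --> 0%E]].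

(** Stability under intersection is the union bound on complements. The instance opens [near]
    reasoning and products with neighbourhood filters, on which the compactness arguments rely. *)
Global Instance whp_filter : Filter whp.
Proof.
split.
- exists (fun=> setT); split => //.
  by rewrite setCT measure0; exact: cvg_cst.
- move=> S1 S2 [W1 [mW1 WS1 P1]] [W2 [mW2 WS2 P2]].
  exists (fun n => W1 n `&` W2 n); split.
  + by move=> n; exact: measurableI.
  + by move=> n w [? ?]; split; [exact: WS1|exact: WS2].
  + apply: (@squeeze_cvge _ _ _ _ (cst 0%E) _ (fun n => P (~` W1 n) + P (~` W2 n))%E).
    * apply: nearW => n; rewrite measure_ge0/= setCI.
      by apply: measureU2; exact: measurableC.
    * exact: cvg_cst.
    * by rewrite -[X in _ --> X]adde0; apply: cvgeD.
- move=> S1 S2 S12 [W [mW WS cW]]; exists W; split => // n w Wnw.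
  by apply: S12; exact: WS.
Qed.

Lemma whp_eventually (N : nat) : \forall z \near whp, (N <= z.1)%N.
Proof.
exists (fun n => if (N <= n)%N then setT else set0); split.
- by move=> n; case: ifP.
- by move=> n w; case: ifP.
- apply: (@cvg_near_cst) => /=; exists N => // n /= ->.
  by rewrite setCT measure0.
Qed.

(** The passage between limits of probabilities and the filter. Measurability lets the complement of
    [A n] serve as witness in one direction and gives monotonicity of [P] in the other. *)
Lemma whp_notP (A : nat -> set T) : (forall n, measurable (A n)) ->
  (P (A n) @[n --> \oo] --> 0%E) <-> \forall z \near whp, ~ A z.1 z.2.
Proof.
move=> mA; split.
- move=> PA; exists (fun n => ~` A n); split => //.
  + by move=> n; exact: measurableC.
  + by under eq_fun do rewrite setCK.
- move=> [W [mW WA PW]].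
  apply: (@squeeze_cvge _ _ _ _ (cst 0%E) _ (fun n => P (~` W n))) => //.
    apply: nearW => n; rewrite measure_ge0/=; apply: le_measure; rewrite ?inE//.
      exact: measurableC.
    by move=> w Aw /WA.
  exact: cvg_cst.
Qed.

(* The intersections of the [A m] over [m >= n] increase to an almost sure event. *)
Lemma whp_ae_eventually (A : nat -> set T) : (forall n, measurable (A n)) ->
  {ae P, forall w, \forall n \near \oo, A n w} -> \forall z \near whp, A z.1 z.2.
Proof.
move=> mA [N [mN N0 sub]].
pose W n := \bigcap_(m in [set m | (n <= m)%N]) A m.
have mW n : measurable (W n) by apply: bigcap_measurable => //; exists n => /=.
have ndW : nondecreasing_seq (fun n => W n).
  move=> n m nm; apply/subsetPset => w Ww k /= mk; apply: Ww.
  exact: leq_trans nm mk.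
exists W; split => //.
- by move=> n w; apply => /=.
- have C0 : P (\bigcap_n ~` W n) = 0%E.
    apply/eqP; rewrite -measure_le0 -N0; apply: le_measure; rewrite ?inE//.
      by apply: bigcap_measurable => // n _; exact: measurableC.
    move=> w CW; apply: sub => /= -[n _ An]; apply: (CW n I) => m /= nm.
    exact: An.
  rewrite -C0; apply: nonincreasing_cvg_mu => //.
  + by rewrite (le_lt_trans (probability_le1 P _)) ?ltry//; exact: measurableC.
  + by move=> n; exact: measurableC.
  + by apply: bigcap_measurable => // n _; exact: measurableC.
  + by move=> n m nm; apply/subsetPset/subsetC/subsetPset/ndW.
Qed.

Lemma whp_mean (U : nat -> T -> R) (m e : R) :
  (forall i, measurable_fun setT (U i)) -> (forall i w, 0 <= U i w <= 1) ->
  (forall i, \int[P]_w U i w = m) ->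
  (forall i j, i != j -> indep2 P (U i) (U j)) -> 0 < e ->
  \forall z \near whp, `|z.1%:R^-1 * (\sum_(i < z.1) U i z.2) - m| < e.
Proof.
move=> mU U01 Um UU e0.
pose A n := [set w | e <= `|n%:R^-1 * (\sum_(i < n) U i w) - m|].
have mA n : measurable (A n).
  apply: measurable_ler_set => //.
  apply: measurableT_comp => //; apply: measurable_funB => //.
  by apply: measurable_funM => //; apply: measurable_sum => i; exact: mU.
have : P (A n) @[n --> \oo] --> 0%E.
  (* The shift drops the sample size 0, which Chebyshev's bound does not cover. *)
  suff PA : P (A n.+1) @[n --> \oo] --> 0%E by rewrite -(cvg_shiftS (fun n => P (A n))).
  apply: (@squeeze_cvge _ _ _ _ (cst 0%E) _
      (fun n => ((e ^+ 2)^-1 * n.+1%:R^-1)%:E)).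
  - apply: nearW => n; rewrite measure_ge0/= -invfM.
    exact: weak_law_bound.
  - exact: cvg_cst.
  - apply: cvg_EFin; first exact: nearW.
    rewrite -[X in _ --> X](mulr0 ((e ^+ 2)^-1)); apply: cvgM; first exact: cvg_cst.
    exact: cvg_harmonic.
move=> /(whp_notP mA); apply: filterS => z /=.
by move=> /negP; rewrite -ltNge.
Qed.

End with_high_probability.

(** * Sample means of a function of identically distributed variables *)

Section identically_distributed.
Context d d1 (T : measurableType d) (T1 : measurableType d1) (R : realType)
  (P : probability T R).

Lemma same_law_Rintegral (U V : {RV P >-> T1}) (f : T1 -> R) :
  measurable_fun setT f -> (forall x, 0 <= f x) -> same_law P U V ->
  \int[P]_w f (U w) = \int[P]_w f (V w).
Proof.
move=> mf f0 UV; congr fine.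
have mf' : measurable_fun setT (EFin \o f) by exact/measurable_EFinP.
have <- := @ge0_integral_distribution _ _ _ _ _ P U (EFin \o f) mf'; last first.
  by move=> x; rewrite lee_fin.
have <- := @ge0_integral_distribution _ _ _ _ _ P V (EFin \o f) mf'; last first.
  by move=> x; rewrite lee_fin.
by apply: eq_measure_integral => A mA _; exact: UV.
Qed.

Lemma whp_mean_law (Us : nat -> {RV P >-> T1}) (U : {RV P >-> T1}) (f : T1 -> R)
    (e : R) :
  (forall i, same_law P (Us i) U) ->
  (forall i j, i != j -> indep2 P (Us i) (Us j)) ->
  measurable_fun setT f -> (forall x, 0 <= f x <= 1) -> 0 < e ->
  \forall z \near whp P,
    `|z.1%:R^-1 * (\sum_(i < z.1) f (Us i z.2)) - \int[P]_w f (U w)| < e.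
Proof.
move=> UsU UU mf f01 e0; apply: (whp_mean (U := fun i w => f (Us i w))) => //.
- by move=> i; apply: measurableT_comp.
- by move=> i; apply: same_law_Rintegral => // x; have /andP[] := f01 x.
- by move=> i j ij; apply: indep2_comp => //; exact: UU.
Qed.

End identically_distributed.

(** * Pairwise independence within each sample *)

Section joint_independence.
Context d d1 d2 (T : measurableType d) (T1 : measurableType d1)
  (T2 : measurableType d2) (R : realType) (P : probability T R)
  (U : nat -> T -> T1) (V : nat -> T -> T2).
Hypothesis UV : mutual_indep P (joint_sigma U V).

Lemma mutual_indep_pair (k l : nat + nat) (A B : set T) : k != l ->
  joint_sigma U V k A -> joint_sigma U V l B -> P (A `&` B) = (P A * P B)%E.
Proof.
move=> kl kA lB.
(* Mutual independence is applied to a two-element list; since [k != l], the family takes the value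
   [A] at [k] and [B] at [l]. *)
have := UV (J := [:: k; l]) (A := fun i => if i == k then A else B).
rewrite !big_cons big_nil eqxx eq_sym (negbTE kl) mule1 => <-.
- congr (P _); rewrite eqEsubset; split => w /=.
    move=> [Aw Bw] i /=; rewrite !inE; case: eqP => [_ //|_] /=.
    by move=> /eqP _.
  move=> H; split.
    by have := H k; rewrite /= !inE eqxx; apply.
  by have := H l; rewrite /= !inE eqxx eq_sym (negbTE kl) orbT; apply.
- by rewrite /= inE kl.
- move=> i; rewrite !inE; case: eqP => [-> //|_ /= /eqP ->//].
Qed.

Lemma joint_indepl i j : i != j -> indep2 P (U i) (U j).
Proof.
move=> ij A B mA mB; apply: (@mutual_indep_pair (inl i) (inl j)) => //=.
  by exists A => //; rewrite setTI.
by exists B => //; rewrite setTI.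
Qed.

Lemma joint_indepr i j : i != j -> indep2 P (V i) (V j).
Proof.
move=> ij A B mA mB; apply: (@mutual_indep_pair (inr i) (inr j)) => //=.
  by exists A => //; rewrite setTI.
by exists B => //; rewrite setTI.
Qed.

End joint_independence.

(** * Continuous distribution functions: uniform convergence and separation *)

Definition continuous_cdf (R : realType) (F : R -> R) : Prop :=
  [/\ {homo F : x y / x <= y}, forall x, 0 <= F x <= 1, continuous F,
      F x @[x --> +oo] --> (1 : R) & F x @[x --> -oo] --> (0 : R)].

Section continuous_cdf_theory.
Context (R : realType) (F : R -> R).
Hypothesis cdfF : continuous_cdf F.

Lemma continuous_cdf_lt (e : R) : 0 < e -> exists a, F a < e.
Proof.
case: cdfF => _ _ _ _ F0 e0.
have /cvgrPdist_lt/(_ e e0)[a [_ Fa]] := F0.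
exists (a - 1); have /Fa : a - 1 < a by lra.
by rewrite sub0r normrN; apply: le_lt_trans; exact: ler_norm.
Qed.

Lemma continuous_cdf_gt (e : R) : 0 < e -> exists b, 1 - e < F b.
Proof.
case: cdfF => _ _ _ F1 _ e0.
have /cvgrPdist_lt/(_ e e0)[b [_ Fb]] := F1.
exists (b + 1); have /Fb : b < b + 1 by lra.
by rewrite ltr_distlC => /andP[+ _]; lra.
Qed.

Lemma continuous_cdf_surj (p : R) : 0 < p < 1 -> exists x, F x = p.
Proof.
move=> /andP[p0 p1]; have [homoF _ cF _ _] := cdfF.
have [a Fa] := continuous_cdf_lt p0.
have [b Fb] : exists b, 1 - (1 - p) < F b by apply: continuous_cdf_gt; lra.
have ab : a <= b.
  by rewrite leNgt; apply/negP => /ltW/homoF; lra.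
have [||c _ Fc] := @IVT R F a b p ab _ _; last by exists c.
- by apply: continuous_subspaceT => x; exact: cF.
- by rewrite ge_min le_max; apply/andP; split; apply/orP; [left|right]; lra.
Qed.

(* Pólya's theorem, by compactness of a segment carrying most of the mass. *)
Lemma continuous_cdf_uniform (I : Type) (FI : set_system I) (f : I -> R -> R) :
  Filter FI ->
  (forall i, {homo f i : x y / x <= y}) -> (forall i x, 0 <= f i x <= 1) ->
  (forall x e, 0 < e -> \forall i \near FI, `|f i x - F x| < e) ->
  forall e, 0 < e -> \forall i \near FI, forall x, `|f i x - F x| < e.
Proof.
move=> FFI homof f01 fF e e0; have [homoF F01 cF _ _] := cdfF.
have e3 : 0 < e / 3 by lra.
have [a Fa] := continuous_cdf_lt e3.
have [b Fb] := continuous_cdf_gt e3.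
have Sab : \forall i \near FI, [set` `[a, b]] `<=` [set x | `|f i x - F x| < e].
  have /compact_near_coveringP := @segment_compact R a b.
  apply => // x _.
  (* Around [x], monotonicity squeezes [f i y] and [F y] between values at [x - r / 2] and
     [x + r / 2], so closeness at these two points controls the whole neighbourhood. *)
  have /cvgrPdist_lt/(_ _ e3)/nbhs_ballP[r /= r0 Fr] := cF x.
  have r2 : `|r / 2| < r by rewrite gtr0_norm; lra.
  have Fu : `|F x - F (x - r / 2)| < e / 3.
    by apply: Fr; rewrite /ball/= opprB addrC subrK.
  have Fv : `|F x - F (x + r / 2)| < e / 3.
    by apply: Fr; rewrite /ball/= opprD addrA subrr sub0r normrN.
  exists ([set y | `|x - y| < r / 2],
      [set i | `|f i (x - r / 2) - F (x - r / 2)| < e / 3 /\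
               `|f i (x + r / 2) - F (x + r / 2)| < e / 3]) => /=.
    split; first by apply/nbhs_ballP; exists (r / 2); [rewrite /= divr_gt0|].
    by apply: filterI; apply: fF.
  move=> [y i] /= [xy [fu fv]].
  have yl : x - r / 2 <= y by move: xy; rewrite ltr_norml; lra.
  have yr : y <= x + r / 2 by move: xy; rewrite ltr_norml; lra.
  have := homof i _ _ yl; have := homof i _ _ yr.
  have := homoF _ _ yl; have := homoF _ _ yr.
  move: Fu Fv fu fv; rewrite !ltr_norml; lra.
near=> i => x.
(* Outside the segment, closeness at [a] or at [b] suffices: both functions lie near 0 to the left
   of [a] and near 1 to the right of [b]. *)
have [xa|ax] := leP x a.
  have fa : `|f i a - F a| < e / 3 by near: i; apply: fF.
  have := homof i _ _ xa; have := homoF _ _ xa.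
  by have := f01 i x; have := F01 x; move: fa; rewrite !ltr_norml; lra.
have [xb|bx] := leP x b.
  have : [set` `[a, b]] x by rewrite /= in_itv/= (ltW ax) xb.
  by move: x {ax xb}; near: i.
have fb : `|f i b - F b| < e / 3 by near: i; apply: fF.
have := homof i _ _ (ltW bx); have := homoF _ _ (ltW bx).
by have := f01 i x; have := F01 x; move: fb; rewrite !ltr_norml; lra.
Unshelve. all: by end_near. Qed.

(* Pólya's theorem applied to the translates of [F]. *)
Lemma continuous_cdf_unif_continuous (e : R) : 0 < e ->
  exists2 r, 0 < r & forall x y, `|x - y| < r -> `|F x - F y| < e.
Proof.
move=> e0; have [homoF F01 cF _ _] := cdfF.
have [r /= r0 Fr] : \forall h \near (0 : R), forall x, `|F (x + h) - F x| < e.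
  apply: (@continuous_cdf_uniform R (nbhs (0 : R)) (fun h x => F (x + h))) => //.
    by move=> h x y xy; apply: homoF; rewrite lerD2r.
  move=> x e' e'0.
  have : F (x + h) @[h --> 0] --> F x.
    rewrite -[X in _ --> F X]addr0; apply: continuous_cvg; first exact: cF.
    by apply: cvgD; [exact: cvg_cst|exact: cvg_id].
  by move=> /cvgrPdist_lt/(_ e' e'0); apply: filterS => h; rewrite distrC.
exists r => // x y xy.
have := Fr (x - y); rewrite /ball/= sub0r normrN => /(_ xy y).
by rewrite subrKC.
Qed.

(** Take the point [z] where [F] equals the midpoint of [F y] and [G y]. Between [y] and [z], [F]
    stays on its side of the midpoint while monotonicity keeps [G] beyond [G y]. Half of the
    difference at [y] is thus both a gap between the functions and the [F]-mass of the interval. *)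
Lemma continuous_cdf_gap (G : R -> R) (y : R) :
  {homo G : x y / x <= y} -> (forall x, 0 <= G x <= 1) -> F y != G y ->
  exists u v t : R, [/\ 0 < t, t <= F v - F u &
    t <= F u - G v \/ t <= G u - F v].
Proof.
move=> homoG G01; have [homoF F01 _ _ _] := cdfF.
have := F01 y; have := G01 y.
rewrite neq_lt => ? ? /orP[FG|GF].
  have [|z Fz] := @continuous_cdf_surj ((F y + G y) / 2); first lra.
  by exists y, z, ((G y - F y) / 2); split; [lra|lra|right; lra].
have [|z Fz] := @continuous_cdf_surj ((F y + G y) / 2); first lra.
by exists z, y, ((F y - G y) / 2); split; [lra|lra|left; lra].
Qed.

End continuous_cdf_theory.

(** * Empirical and fitted distribution functions, and the criterion as a sample mean *)

Definition model_cdf (R : realType) (k n : nat) (F : R -> R)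
    (xs : nat -> k.-tuple R) (b : k.-tuple R) (y : R) : R :=
  n%:R^-1 * \sum_(i < n) F (y - dotp b (xs i)).

Lemma mean01 (R : realType) (n : nat) (f : nat -> R) :
  (forall i, 0 <= f i <= 1) -> 0 <= n%:R^-1 * \sum_(i < n) f i <= 1.
Proof.
move=> f01; have f0 i : 0 <= f i by have /andP[] := f01 i.
rewrite mulr_ge0 ?invr_ge0 ?sumr_ge0//=.
(* For an empty sample the mean is 0. *)
have [->|n0] := posnP n; first by rewrite big_ord0 mulr0 ler01.
rewrite ler_pdivrMl ?ltr0n// mulr1.
apply: (@le_trans _ _ (\sum_(i < n) 1)); last by rewrite sumr_const card_ord.
by apply: ler_sum => i _; have /andP[] := f01 i.
Qed.

Lemma ler_mean (R : realType) (n : nat) (f g : nat -> R) :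
  (forall i, f i <= g i) ->
  n%:R^-1 * \sum_(i < n) f i <= n%:R^-1 * \sum_(i < n) g i.
Proof. by move=> fg; rewrite ler_wpM2l ?invr_ge0//; apply: ler_sum. Qed.

Section empirical.
Context (R : realType) (n : nat).
Implicit Types (ys : nat -> R).

Lemma emp_cdf_homo ys : {homo emp_cdf n ys : x y / x <= y}.
Proof.
move=> x y xy; apply: (ler_mean n (f := fun i => (ys i <= x)%R%:R)
  (g := fun i => (ys i <= y)%R%:R)) => i.
by rewrite ler_nat; case: (leP (ys i) x) => // yx; rewrite (le_trans yx xy).
Qed.

Lemma emp_cdf01 ys y : 0 <= emp_cdf n ys y <= 1.
Proof.
apply: (mean01 n (f := fun i => (ys i <= y)%R%:R)) => i.
by case: (ys i <= y); rewrite ?lexx ?ler01.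
Qed.

(* Only the sample points in ]u, v] are used: their proportion is at least [s],
   and each contributes at least [s ^+ 2]. *)
Lemma mean_sqr_gap ys (H : R -> R) (u v s : R) : {homo H : x y / x <= y} ->
  0 <= s -> s <= emp_cdf n ys v - emp_cdf n ys u ->
  s <= emp_cdf n ys u - H v \/ s <= H u - emp_cdf n ys v ->
  s ^+ 3 <= n%:R^-1 * \sum_(i < n) (emp_cdf n ys (ys i) - H (ys i)) ^+ 2.
Proof.
move=> homoH s0 suv sH.
apply: (@le_trans _ _ (s ^+ 2 * (emp_cdf n ys v - emp_cdf n ys u))).
  by rewrite exprSr ler_wpM2l ?exprn_ge0.
rewrite /emp_cdf -mulrBr mulrCA -sumrB mulr_sumr -/(emp_cdf n ys).
apply: (ler_mean n (f := fun i => s ^+ 2 * ((ys i <= v)%R%:R - (ys i <= u)%R%:R))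
  (g := fun i => (emp_cdf n ys (ys i) - H (ys i)) ^+ 2)) => i.
have [yu|uy] := leP (ys i) u.
  apply: (@le_trans _ _ 0); last exact: sqr_ge0.
  by rewrite mulr_ge0_le0 ?exprn_ge0//; case: (_ <= v); rewrite ?subrr// sub0r oppr_le0.
have [yv|vy] := leP (ys i) v; last by rewrite subrr mulr0 sqr_ge0.
rewrite subr0 mulr1.
have := @emp_cdf_homo ys _ _ yv; have := @emp_cdf_homo ys _ _ (ltW uy).
have := homoH _ _ yv; have := homoH _ _ (ltW uy).
by case: sH => ?; nra.
Qed.

Lemma mean_sqr_uniform ys (H : R -> R) (s : R) :
  (forall y, `|emp_cdf n ys y - H y| <= s) ->
  n%:R^-1 * \sum_(i < n) (emp_cdf n ys (ys i) - H (ys i)) ^+ 2 <= s ^+ 2.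
Proof.
move=> sH; have s0 : 0 <= s by apply: le_trans (sH 0).
apply: (le_trans (ler_mean n (f := fun i => (emp_cdf n ys (ys i) - H (ys i)) ^+ 2)
  (g := fun=> s ^+ 2) _)).
  move=> i; rewrite -real_normK ?num_real// lerXn2r ?nnegrE//.
have [->|n0] := posnP n; first by rewrite big_ord0 mulr0 sqr_ge0.
by rewrite sumr_const card_ord -[X in _ * X]mulr_natl mulrA mulVf ?mul1r// pnatr_eq0 -lt0n.
Qed.

End empirical.

Section empirical_criterion.
Context (R : realType) (k n : nat) (F : R -> R).
Hypothesis homoF : {homo F : x y / x <= y}.

Lemma model_cdf_homo (xs : nat -> k.-tuple R) b :
  {homo model_cdf n F xs b : x y / x <= y}.
Proof.
move=> x y xy; apply: (ler_mean n (f := fun i => F (x - dotp b (xs i)))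
  (g := fun i => F (y - dotp b (xs i)))) => i.
by apply: homoF; rewrite lerD2r.
Qed.

Lemma model_cdf01 (xs : nat -> k.-tuple R) b y :
  (forall x, 0 <= F x <= 1) -> 0 <= model_cdf n F xs b y <= 1.
Proof. by move=> F01; apply: (mean01 n (f := fun i => F (y - dotp b (xs i)))). Qed.

(** The empirical measure is a scaled sum of Dirac masses. The integrand is measurable as the square
    of a difference of monotone functions. *)
Lemma Dn2E ys (xs : nat -> k.-tuple R) b : Dn2 n F ys xs b =
  n%:R^-1 * \sum_(i < n) (emp_cdf n ys (ys i) - model_cdf n F xs b (ys i)) ^+ 2.
Proof.
pose g y := ((emp_cdf n ys y - model_cdf n F xs b y) ^+ 2)%:E.
have mg : measurable_fun setT g.
  apply/measurable_EFinP; apply: measurable_funX; apply: measurable_funB.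
    by apply: nondecreasing_measurable => //; exact: emp_cdf_homo.
  by apply: nondecreasing_measurable => //; exact: model_cdf_homo.
have g0 y : (0 <= g y)%E by rewrite lee_fin sqr_ge0.
rewrite /Dn2 /Rintegral (_ : (\int[_]_y _)%E = \int[emp_measure n ys]_y g y)%E//.
rewrite /emp_measure ge0_integral_mscale// ge0_integral_measure_sum//.
under eq_bigr do rewrite integral_dirac// diracT mul1e.
by rewrite sumEFin.
Qed.

End empirical_criterion.

(** * Estimates for expectations and dot products *)

Lemma Rintegral_dist d (T : measurableType d) (R : realType)
    (P : probability T R) (f g : T -> R) (e : R) :
  P.-integrable setT (EFin \o f) -> P.-integrable setT (EFin \o g) ->
  (forall w, `|f w - g w| <= e) -> `|\int[P]_w f w - \int[P]_w g w| <= e.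
Proof.
move=> If Ig fg; rewrite -RintegralB//.
have Ifg : P.-integrable setT (EFin \o (fun w => f w - g w)).
  by have := @integrableB _ _ _ P setT measurableT _ _ If Ig.
apply: (le_trans (le_normr_Rintegral _ Ifg)) => //.
rewrite -(Rintegral_cst_prob P e); apply: le_Rintegral => //.
  by have := @integrable_abse _ _ _ P setT _ Ifg.
by apply: (@bounded_integrable _ _ _ _ _ `|e|).
Qed.

Section dot_product.
Context (R : realType) (k : nat).
Implicit Types b x : k.-tuple R.

(** The norm dual to the coordinatewise maximum: it controls the change of [dotp b x] when every
    coordinate of [b] moves by at most [r]. *)
Definition norm1 x : R := \sum_(i < k) `|tnth x i|.

Lemma dotpE b x : dotp b x = \sum_(i < k) tnth b i * tnth x i.
Proof. by rewrite /dotp mxE; apply: eq_bigr => i _; rewrite !mxE. Qed.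

Lemma dotp_dist b b' x (r : R) :
  (forall i, `|tnth b i - tnth b' i| <= r) ->
  `|dotp b x - dotp b' x| <= r * norm1 x.
Proof.
move=> br; rewrite !dotpE -sumrB mulr_sumr.
apply: (le_trans (ler_norm_sum _ _ _)); apply: ler_sum => i _.
by rewrite -mulrBl normrM ler_wpM2r.
Qed.

Lemma measurable_dotp d (T : measurableType d) (f g : T -> k.-tuple R) :
  measurable_fun setT f -> measurable_fun setT g ->
  measurable_fun setT (fun w => dotp (f w) (g w)).
Proof.
move=> mf mg; under eq_fun do rewrite dotpE.
apply: measurable_sum => i; apply: measurable_funM.
  exact: (measurableT_comp (measurable_tnth i) mf).
exact: (measurableT_comp (measurable_tnth i) mg).
Qed.

Lemma measurable_norm1 : measurable_fun setT norm1.
Proof.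
apply: measurable_sum => i; apply: measurableT_comp => //.
exact: measurable_tnth.
Qed.

End dot_product.

(** * Real-valued distribution functions of random variables *)

Section cdfR_theory.
Context d (T : measurableType d) (R : realType) (P : probability T R).
Implicit Types Z : {RV P >-> R}.

Lemma EFin_cdfR Z y : (cdfR Z y)%:E = cdf Z y.
Proof. by rewrite /cdfR fineK// fin_num_measure. Qed.

Lemma cdfR_homo Z : {homo cdfR Z : x y / x <= y}.
Proof. by move=> x y xy; rewrite -lee_fin !EFin_cdfR; exact: cdf_nondecreasing. Qed.

Lemma cdfR01 Z y : 0 <= cdfR Z y <= 1.
Proof. by rewrite -!lee_fin EFin_cdfR cdf_ge0 cdf_le1. Qed.

Lemma cvg_cdfRy1 Z : cdfR Z x @[x --> +oo] --> (1 : R).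
Proof. by have /fine_cvg := cvg_cdfy1 Z. Qed.

Lemma cvg_cdfRNy0 Z : cdfR Z x @[x --> -oo] --> (0 : R).
Proof. by have /fine_cvg := cvg_cdfNy0 Z. Qed.

Lemma continuous_cdfR Z : continuous (cdfR Z) -> continuous_cdf (cdfR Z).
Proof.
move=> cZ; split.
- exact: cdfR_homo.
- exact: cdfR01.
- exact: cZ.
- exact: cvg_cdfRy1.
- exact: cvg_cdfRNy0.
Qed.

Lemma Rintegral_le_cdfR Z y : \int[P]_w (Z w <= y)%R%:R = cdfR Z y.
Proof.
have mA : measurable (Z @^-1` `]-oo, y]) by exact: measurable_funPTI.
rewrite /cdfR /cdf /distribution /pushforward -(Rintegral_indic P mA).
apply: eq_Rintegral => w _; rewrite indicE.
by congr (nat_of_bool _)%:R; apply/idP/idP; rewrite !inE/= in_itv.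
Qed.

End cdfR_theory.

(** * The distribution function of the model *)

Section convolution.
Context d (T : measurableType d) (R : realType) (P : probability T R) (k : nat).
Context (X : {RV P >-> k.-tuple R}) (F : R -> R).
Hypothesis homoF : {homo F : x y / x <= y}.
Hypothesis F01 : forall x, 0 <= F x <= 1.

Let F0 x : 0 <= F x. Proof. by have /andP[] := F01 x. Qed.

Let F1 x : `|F x| <= 1. Proof. by rewrite ger0_norm//; have /andP[] := F01 x. Qed.

Lemma measurable_model b y : measurable_fun setT (fun x : k.-tuple R => F (y - dotp b x)).
Proof.
apply: (measurableT_comp (nondecreasing_measurable measurableT homoF)).
by apply: measurable_funB => //; apply: measurable_dotp.
Qed.

Lemma integrable_model b y :
  P.-integrable setT (EFin \o (fun w => F (y - dotp b (X w)))).
Proof.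
apply: (@bounded_integrable _ _ _ _ _ 1) => //.
exact: (measurableT_comp (measurable_model b y)).
Qed.

Lemma conv_cdfE b y : conv_cdf X F b y = \int[P]_w F (y - dotp b (X w)).
Proof.
congr fine; apply: (@ge0_integral_distribution _ _ _ _ _ P X
  (fun x => (F (y - dotp b x))%:E)); last by move=> x; rewrite lee_fin.
by apply/measurable_EFinP; exact: measurable_model.
Qed.

Lemma conv_cdf_homo b : {homo conv_cdf X F b : x y / x <= y}.
Proof.
move=> x y xy; rewrite !conv_cdfE; apply: le_Rintegral => //;
  [exact: integrable_model..|].
by move=> w _; apply: homoF; rewrite lerD2r.
Qed.

Lemma conv_cdf01 b y : 0 <= conv_cdf X F b y <= 1.
Proof.
rewrite conv_cdfE Rintegral_ge0//= -(Rintegral_cst_prob P 1).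
apply: le_Rintegral => //; first exact: integrable_model.
  by apply: (@bounded_integrable _ _ _ _ _ 1) => // w; rewrite normr1.
by move=> w _; have /andP[] := F01 (y - dotp b (X w)).
Qed.

(** A modulus of uniform continuity of [F] serves all its translates at once, hence also their
    average. *)
Lemma conv_cdf_continuous b : continuous_cdf F -> continuous (conv_cdf X F b).
Proof.
move=> cF y; apply/cvgrPdist_le => e e0.
have [r r0 Fr] := continuous_cdf_unif_continuous cF e0.
apply/nbhs_ballP; exists r => //= z; rewrite /ball/= => yz.
rewrite !conv_cdfE; apply: Rintegral_dist; [exact: integrable_model..|].
by move=> w; apply/ltW/Fr; rewrite opprB addrA subrK.
Qed.

End convolution.

(** By independence, the probability that [dotp b X + eps <= y] is a product measure, hence an
    integral over [x] of the law of [eps] on the section at [x]. That section is the half-line up to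
    [y - dotp b x], which yields the convolution. *)
Lemma B0_of_same_law d (T : measurableType d) (R : realType) (P : probability T R)
    (k : nat) (X : {RV P >-> k.-tuple R}) (eps Y : {RV P >-> R})
    (b : k.-tuple R) :
  indep2 P X eps -> same_law P Y (fun w => dotp b (X w) + eps w) ->
  B0 X eps Y b.
Proof.
move=> Xeps YX y.
pose A := [set z : k.-tuple R * R | dotp b z.1 + z.2 <= y].
have mA : measurable A.
  apply: measurable_ler_set => //.
  by apply: measurable_funD => //; apply: measurable_dotp.
have -> : cdfR Y y = fine (P ((fun w => (X w, eps w)) @^-1` A)).
  rewrite /cdfR /cdf /distribution /pushforward YX//.
rewrite -(indep2_law_pair Xeps)// /product_measure1 /conv_cdf /Rintegral.
congr fine; apply: eq_integral => x _ /=; rewrite EFin_cdfR /cdf.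
congr (distribution P eps _); rewrite eqEsubset; split => e /=;
  by rewrite in_itv/= /xsection/= inE /A/= lerBrDl.
Qed.

(** * Topology of the parameter space *)

Section coordinates.
Context (R : realType) (k : nat).
Implicit Types (b : k.-tuple R) (v : 'rV[R]_k).

(** Measurability is handled on tuples, continuity and compactness on row vectors; this map links
    the two. *)
Definition tuple_of_row v : k.-tuple R := [tuple v ord0 i | i < k].

Lemma tnth_tuple_of_row v i : tnth (tuple_of_row v) i = v ord0 i.
Proof. by rewrite tnth_mktuple. Qed.

Lemma tuple_of_row_tnth b : tuple_of_row (\row_i tnth b i) = b.
Proof. by apply: eq_from_tnth => i; rewrite tnth_tuple_of_row mxE. Qed.

Lemma normGE (G : 'M[R]_k) b :
  normG G b = Num.sqrt (\sum_(j < k) (\sum_(i < k) tnth b i * G i j) * tnth b j).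
Proof.
rewrite /normG mxE; congr Num.sqrt; apply: eq_bigr => j _.
by rewrite !mxE; congr (_ * _); apply: eq_bigr => i _; rewrite !mxE.
Qed.

Lemma tnth_le_norm2 b i : `|tnth b i| <= norm2 b.
Proof.
rewrite -sqrtr_sqr /norm2 ler_sqrt ?dotpE.
  by rewrite (bigD1 i)//= -expr2 lerDl sumr_ge0// => j _; rewrite -expr2 sqr_ge0.
by apply: sumr_ge0 => j _; rewrite -expr2 sqr_ge0.
Qed.

Lemma normG_continuous (G : 'M[R]_k) :
  continuous (fun v : 'rV[R]_k => normG G (tuple_of_row v)).
Proof.
under eq_fun do rewrite normGE; move=> v.
apply: (@continuous_comp _ _ _ (fun v : 'rV[R]_k => \sum_(j < k)
    (\sum_(i < k) tnth (tuple_of_row v) i * G i j) * tnth (tuple_of_row v) j)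
  (@Num.sqrt R)); last exact: sqrt_continuous.
have cvgv i : tnth (tuple_of_row x) i @[x --> v] --> tnth (tuple_of_row v) i.
  rewrite tnth_tuple_of_row; under eq_fun do rewrite tnth_tuple_of_row.
  exact: coord_continuous.
have FF : Filter (nbhs v) by exact: nbhs_filter.
apply: (cvg_big _ FF) => [|j _]; first exact: add_continuous.
apply: cvgM => //; apply: (cvg_big _ FF) => [|i _]; first exact: add_continuous.
by apply: cvgM => //; apply: cvg_cst; exact: nbhs_filter.
Qed.

Lemma measurable_normG d (T : measurableType d) (G : 'M[R]_k) (f : T -> k.-tuple R) :
  measurable_fun setT f -> measurable_fun setT (fun w => normG G (f w)).
Proof.
move=> mf; under eq_fun do rewrite normGE.
have mfi i : measurable_fun setT (fun w => tnth (f w) i).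
  exact: (measurableT_comp (measurable_tnth i) mf).
apply: (measurableT_comp (f := @Num.sqrt R)).
  by apply: continuous_measurable_fun; exact: sqrt_continuous.
apply: measurable_sum => j; apply: measurable_funM => //.
by apply: measurable_sum => i; apply: measurable_funM.
Qed.

Lemma near_tuple_of_row v (r : R) : 0 < r -> \forall v' \near v,
  forall i, `|tnth (tuple_of_row v') i - tnth (tuple_of_row v) i| < r.
Proof.
move=> r0; apply/nbhs_ballP; exists r => //= v' [_ vv'] i.
by rewrite !tnth_tuple_of_row distrC; exact: vv'.
Qed.

Lemma box_compact (K : R) : compact [set v : 'rV[R]_k | forall i, `|v ord0 i| <= K].
Proof.
have := @rV_compact R k (fun=> [set` `[- K, K]]) (fun=> @segment_compact R _ _).
congr compact; rewrite eqEsubset.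
by split => v /= vK i; have := vK i; rewrite /= in_itv/= ler_norml.
Qed.

End coordinates.

(** * Asymptotic comparison of the criterion at different vectors *)

Section consistency.
Context d (T : measurableType d) (R : realType) (P : probability T R) (k : nat).
Context (X : {RV P >-> k.-tuple R}) (Y : {RV P >-> R}) (F : R -> R).
Context (Xs : nat -> {RV P >-> k.-tuple R}) (Ys : nat -> {RV P >-> R}).
Hypothesis cdfF : continuous_cdf F.
Hypothesis XsX : forall i, same_law P (Xs i) X.
Hypothesis YsY : forall i, same_law P (Ys i) Y.
Hypothesis XX : forall i j, i != j -> indep2 P (Xs i) (Xs j).
Hypothesis YY : forall i j, i != j -> indep2 P (Ys i) (Ys j).

Let homoF : {homo F : x y / x <= y}. Proof. by case: cdfF. Qed.
Let F01 x : 0 <= F x <= 1. Proof. by case: cdfF. Qed.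

(** The pair [z] of a sample size and an outcome is the variable of the filter [whp]. *)
Let emp (z : nat * T) := emp_cdf z.1 (fun i => Ys i z.2).
Let model (z : nat * T) := model_cdf z.1 F (fun i => Xs i z.2).
Let crit (z : nat * T) := Dn2 z.1 F (fun i => Ys i z.2) (fun i => Xs i z.2).

Let critE z b : crit z b = z.1%:R^-1 *
  \sum_(i < z.1) (emp z (Ys i z.2) - model z b (Ys i z.2)) ^+ 2.
Proof. exact: Dn2E. Qed.

Lemma whp_emp_cdf (y e : R) : 0 < e ->
  \forall z \near whp P, `|emp z y - cdfR Y y| < e.
Proof.
move=> e0; rewrite -Rintegral_le_cdfR.
refine (whp_mean_law (f := fun x : R => (x <= y)%R%:R) YsY YY _ _ e0).
  exact: measurable_ler_nat.
by move=> x; case: (x <= y); rewrite ?lexx ?ler01.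
Qed.

Lemma whp_model_cdf b (y e : R) : 0 < e ->
  \forall z \near whp P, `|model z b y - conv_cdf X F b y| < e.
Proof.
move=> e0; rewrite conv_cdfE//.
refine (whp_mean_law (f := fun x => F (y - dotp b x)) XsX XX _ _ e0) => //.
exact: measurable_model.
Qed.

Lemma whp_tight (e : R) : 0 < e -> exists M : R, 0 < M /\ \forall z \near whp P,
  1 - e < z.1%:R^-1 * \sum_(i < z.1) (norm1 (Xs i z.2) <= M)%R%:R.
Proof.
move=> e0.
have mS : measurable_fun setT (fun w => norm1 (X w)).
  by apply: (measurableT_comp (@measurable_norm1 R k)).
pose S : {RV P >-> R} := mfun_Sub (mem_set mS).
have /cvgrPdist_lt/(_ (e / 2))[|M0 [_ SM0]] := cvg_cdfRy1 S; first by lra.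
(* Beyond [M0] the law of [norm1 X] leaves mass less than [e / 2]; the sampling error takes the
   other half. The maximum with 0 makes [M] positive. *)
pose M := Num.max M0 0 + 1.
have M00 : M0 <= Num.max M0 0 by rewrite le_max lexx.
have M0' : 0 <= Num.max M0 0 by rewrite le_max lexx orbT.
have /SM0 SM : M0 < M by rewrite /M; lra.
exists M; split; first by rewrite /M; lra.
have e2 : 0 < e / 2 by lra.
have : \forall z \near whp P, `|z.1%:R^-1 * (\sum_(i < z.1) (norm1 (Xs i z.2) <= M)%R%:R)
    - \int[P]_w (norm1 (X w) <= M)%R%:R| < e / 2.
  refine (whp_mean_law (f := fun x => (norm1 x <= M)%R%:R) XsX XX _ _ e2).
    by apply: measurable_ler_nat => //; exact: measurable_norm1.
  by move=> x; case: (norm1 x <= M); rewrite ?lexx ?ler01.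
apply: filterS => z; have := Rintegral_le_cdfR S M; rewrite /S/= => ->.
by move: SM; rewrite !ltr_norml; lra.
Qed.

(** Moving [b] slightly changes a term by at most [e / 4] when [norm1] of the covariate is at most
    [M], and by at most 1 otherwise; by tightness the latter terms have proportion below [e / 4].
    The sampling error at [b] itself adds less than [e / 4]. *)
Lemma whp_model_cdf_near (v : 'rV[R]_k) (y e : R) : 0 < e ->
  \forall v' \near v & z \near whp P,
    `|model z (tuple_of_row v') y - conv_cdf X F (tuple_of_row v) y| < e.
Proof.
move=> e0; have e4 : 0 < e / 4 by lra.
have [M [M0 tight]] := whp_tight e4.
have [r r0 Fr] := continuous_cdf_unif_continuous cdfF e4.
(* Dividing by [M + 1] instead of [M] keeps the displacement of the dot product strictly below
   [r]. *)
have rM : 0 < r / (M + 1) by rewrite divr_gt0//; lra.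
exists ([set v' | forall i,
    `|tnth (tuple_of_row v') i - tnth (tuple_of_row v) i| < r / (M + 1)],
  [set z | [/\ (1 <= z.1)%N,
     1 - e / 4 < z.1%:R^-1 * \sum_(i < z.1) (norm1 (Xs i z.2) <= M)%R%:R &
    `|model z (tuple_of_row v) y - conv_cdf X F (tuple_of_row v) y| < e / 4]]).
  split; first exact: near_tuple_of_row.
  have W1 := whp_eventually P 1.
  have W2 := whp_model_cdf (tuple_of_row v) y e4.
  by apply: filterS3 W1 tight W2 => z.
move=> [v' z] /= [vv' [n0 Mz vz]].
set b' := tuple_of_row v'; set b := tuple_of_row v; set n := z.1.
suff : `|model z b' y - model z b y| < e / 2.
  by move: vz; rewrite -/b !ltr_norml; lra.
pose q (i : nat) : R := (norm1 (Xs i z.2) <= M)%R%:R.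
have H i : `|F (y - dotp b' (Xs i z.2)) - F (y - dotp b (Xs i z.2))| <= e / 4 + (1 - q i).
  rewrite /q; have [xM|xM] := leP (norm1 (Xs i z.2)) M.
    rewrite subrr addr0 ltW//; apply: Fr.
    rewrite (_ : _ - _ = dotp b (Xs i z.2) - dotp b' (Xs i z.2)); last by ring.
    rewrite distrC; apply: le_lt_trans.
      by apply: dotp_dist => j; exact: ltW (vv' j).
    apply: (@le_lt_trans _ _ (r / (M + 1) * M)); first by rewrite ler_wpM2l// ltW.
    by rewrite mulrAC ltr_pdivrMr; [nra|lra].
  rewrite subr0 ler_norml; have := F01 (y - dotp b' (Xs i z.2)).
  by have := F01 (y - dotp b (Xs i z.2)); lra.
rewrite /model /model_cdf -mulrBr -sumrB normrM ger0_norm ?invr_ge0//.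
apply: (@le_lt_trans _ _ (n%:R^-1 * \sum_(i < n) (e / 4 + (1 - q i)))).
  rewrite ler_wpM2l ?invr_ge0//; apply: (le_trans (ler_norm_sum _ _ _)).
  by apply: ler_sum => i _; exact: H.
rewrite big_split/= sumrB !sumr_const card_ord mulrDr mulrBr -[e / 4 *+ n]mulr_natl.
rewrite mulKf ?pnatr_eq0 -?lt0n// mulVf ?pnatr_eq0 -?lt0n//.
by move: Mz; rewrite -/n /q; lra.
Qed.

Lemma whp_crit_lt b e : continuous_cdf (cdfR Y) ->
  cdfR Y =1 conv_cdf X F b -> 0 < e -> \forall z \near whp P, crit z b < e.
Proof.
move=> cdfY Yb e0.
(* This choice gives [t ^+ 2 < e], and errors of [t / 2] for each of the two functions add up to
   [t]. *)
pose t := Num.min 1 e / 2.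
have t0 : 0 < t by rewrite divr_gt0// lt_min ltr01.
have t1 : t <= 1 / 2 by rewrite ler_wpM2r// ge_min lexx.
have te : t <= e / 2 by rewrite ler_wpM2r// ge_min lexx orbT.
have t2 : 0 < t / 2 by lra.
have We : \forall z \near whp P, forall y, `|emp z y - cdfR Y y| < t / 2.
  apply: (continuous_cdf_uniform cdfY) => //.
  - by move=> z; exact: emp_cdf_homo.
  - by move=> z; exact: emp_cdf01.
  - exact: whp_emp_cdf.
have Wm : \forall z \near whp P, forall y, `|model z b y - cdfR Y y| < t / 2.
  apply: (continuous_cdf_uniform cdfY) => //.
  - by move=> z; exact: model_cdf_homo.
  - by move=> z y; exact: model_cdf01.
  - by move=> y e' e'0; rewrite Yb; exact: whp_model_cdf.
apply: filterS2 We Wm => z ez mz; rewrite critE.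
apply: (@le_lt_trans _ _ (t ^+ 2)); last by rewrite expr2; nra.
apply: mean_sqr_uniform => y.
rewrite -/(emp z) -/(model z b).
by have := ez y; have := mz y; rewrite !ltr_norml ler_norml; lra.
Qed.

Lemma whp_crit_separated (v : 'rV[R]_k) b : continuous_cdf (cdfR Y) ->
  cdfR Y =1 conv_cdf X F b -> ~ (cdfR Y =1 conv_cdf X F (tuple_of_row v)) ->
  \forall v' \near v & z \near whp P, crit z b < crit z (tuple_of_row v').
Proof.
move=> cdfY Yb /existsNP[y /eqP Yy].
have [u [w [t [t0 tuw tG]]]] := continuous_cdf_gap cdfY
  (conv_cdf_homo X homoF F01 _) (conv_cdf01 X homoF F01 _) Yy.
have t4 : 0 < t / 4 by lra.
(* Errors below [t / 4] at [u] and [w] reduce the mass and the gap from [t] to [t / 2], so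
   [mean_sqr_gap] bounds the criterion near [v] below by [(t / 2) ^+ 3]; at [b] it falls under this
   value. *)
have t3 : 0 < (t / 2) ^+ 3 by rewrite exprn_gt0//; lra.
have Wz : \forall z \near whp P, [/\ `|emp z u - cdfR Y u| < t / 4,
    `|emp z w - cdfR Y w| < t / 4 & crit z b < (t / 2) ^+ 3].
  have W1 := whp_emp_cdf u t4; have W2 := whp_emp_cdf w t4.
  have W3 := whp_crit_lt cdfY Yb t3.
  by apply: filterS3 W1 W2 W3 => z; split.
have {}Wz : \forall v' \near v & z \near whp P, [/\ `|emp z u - cdfR Y u| < t / 4,
    `|emp z w - cdfR Y w| < t / 4 & crit z b < (t / 2) ^+ 3].
  exact: (cvg_snd Wz).
apply: filterS3 Wz (whp_model_cdf_near v u t4) (whp_model_cdf_near v w t4).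
move=> [v' z] /= [eu ew cb] mu mw; apply: (lt_le_trans cb).
rewrite critE; apply: (@mean_sqr_gap _ _ _ _ u w).
- by apply: model_cdf_homo.
- lra.
- by move: eu ew; rewrite -/(emp z) !ltr_norml; lra.
- rewrite -/(emp z) -/(model z (tuple_of_row v')).
  by move: eu ew mu mw; rewrite !ltr_norml; case: tG => *; [left|right]; lra.
Qed.

Lemma whp_crit_separated_box (b : k.-tuple R) (G : 'M[R]_k) (c e K : R) :
  continuous_cdf (cdfR Y) -> cdfR Y =1 conv_cdf X F b ->
  (forall b', cdfR Y =1 conv_cdf X F b' -> normG G b' = c) -> 0 < e ->
  \forall z \near whp P, forall b', (forall i, `|tnth b' i| <= K) ->
    e < `|normG G b' - c| -> crit z b < crit z b'.
Proof.
move=> cdfY Yb GB e0.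
have : \forall z \near whp P, [set v : 'rV[R]_k | forall i, `|v ord0 i| <= K]
    `<=` [set v | e < `|normG G (tuple_of_row v) - c| -> crit z b < crit z (tuple_of_row v)].
  have /compact_near_coveringP := @box_compact R k K; apply => v _.
  (* If the model holds at [v], continuity of the norm makes the premise [e < |normG - c|] false
     near [v]; otherwise the criterion separates a neighbourhood of [v] from [b]. *)
  have [Yv|Yv] := pselect (cdfR Y =1 conv_cdf X F (tuple_of_row v)).
    have /cvgrPdist_lt/(_ e e0) Ge := @normG_continuous R k G v.
    have : \forall v' \near v & z \near whp P,
        `|normG G (tuple_of_row v) - normG G (tuple_of_row v')| < e.
      exact: (cvg_fst Ge).
    apply: filterS => -[v' z] /=; rewrite (GB _ Yv) distrC => Gv.
    by rewrite ltNge (ltW Gv).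
  apply: filterS (whp_crit_separated cdfY Yb Yv) => -[v' z] /= bv _; exact: bv.
apply: filterS => z Vz b' b'K; rewrite -(tuple_of_row_tnth b').
by apply: Vz => i; rewrite mxE.
Qed.

Lemma measurable_crit n (B : T -> k.-tuple R) : measurable_fun setT B ->
  measurable_fun setT (fun w => crit (n, w) (B w)).
Proof.
move=> mB; under eq_fun do rewrite critE /emp /model /emp_cdf /model_cdf/=.
have mF : measurable_fun setT F by exact: nondecreasing_measurable.
apply: measurable_funM => //; apply: measurable_sum => i; apply: measurable_funX.
apply: measurable_funB; apply: measurable_funM => //; apply: measurable_sum => j.
  exact: measurable_ler_nat.
apply: (measurableT_comp mF); apply: measurable_funB => //.
exact: measurable_dotp.
Qed.

End consistency.

(** * Convergence in probability of the norm of the minimizer *)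

Theorem theorem3 (disp : measure_display) (T : measurableType disp)
    (R : realType) (P : probability T R) (d : nat) (hd : (0 < d)%N)
    (X : {RV P >-> d.-tuple R}) (eps Y : {RV P >-> R}) (beta0 : d.-tuple R)
    (hX : atomless_law X)
    (hXeps : indep2 P X eps)
    (hY : same_law P Y (fun w => dotp beta0 (X w) + eps w))
    (Ys : nat -> {RV P >-> R}) (Xs : nat -> {RV P >-> d.-tuple R})
    (hYs : forall i, same_law P (Ys i) Y)
    (hXs : forall i, same_law P (Xs i) X)
    (hindep : mutual_indep P
       (joint_sigma (fun i => Ys i : T -> R) (fun i => Xs i : T -> d.-tuple R)))
    (betahat : nat -> {RV P >-> d.-tuple R})
    (hdlse : {ae P, forall w, \forall n \near \oo,
       is_dlse n (cdfR eps) (fun i => Ys i w) (fun i => Xs i w) (betahat n w)})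
    (heps : continuous (cdfR eps))
    (Gamma : 'M[R]_d) (hGu : Gamma \in unitmx) (hGpd : posdef Gamma)
    (c : R) (hc : 0 <= c)
    (hB0 : forall beta, B0 X eps Y beta -> normG Gamma beta = c)
    (hOP : bounded_in_prob P (fun n w => norm2 (betahat n w))) :
  cvg_in_prob P (fun n w => normG Gamma (betahat n w)) c.
Proof.
have cdfF := continuous_cdfR heps.
have [homoF F01 _ _ _] := cdfF.
have Yb := B0_of_same_law hXeps hY.
have cdfY : continuous_cdf (cdfR Y).
  apply: continuous_cdfR; rewrite (_ : cdfR Y = conv_cdf X (cdfR eps) beta0).
    exact: conv_cdf_continuous.
  exact/funext.
have YY := joint_indepl hindep; have XX := joint_indepr hindep.
pose crit n w := Dn2 n (cdfR eps) (fun i => Ys i w) (fun i => Xs i w).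
(* Comparison with the single vector [beta0] gives a measurable event for each [n], as the passage
   from almost surely eventually to high probability requires. *)
have dlse : \forall z \near whp P,
    crit z.1 z.2 (betahat z.1 z.2) <= crit z.1 z.2 beta0.
  apply: (@whp_ae_eventually _ _ _ P
      (fun n => [set w | crit n w (betahat n w) <= crit n w beta0])).
    move=> n; by apply: measurable_ler_set => //; exact: measurable_crit.
  apply: filterS hdlse => w; apply: filterS => n; exact.
move=> e e0.
have mA n : measurable [set w | e < `|normG Gamma (betahat n w) - c|].
  apply: measurable_ltr_set => //.
  apply: measurableT_comp => //; apply: measurable_funB => //.
  exact: measurable_normG.
apply/fine_cvgP; split.
  by apply: nearW => n; rewrite fin_num_measure.
apply/cvgrPdist_lt => a a0.
have a2 : 0 < a / 2 by lra.
have [K Kbeta] := hOP _ a2.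
have mK n : measurable [set w | K < `|norm2 (betahat n w)|].
  apply: measurable_ltr_set => //.
  apply: measurableT_comp => //.
  rewrite (_ : (fun w => _) = fun w => normG 1%:M (betahat n w)).
    exact: measurable_normG.
  by apply/funext => w; rewrite /normG mulmx1.
pose A n := [set w | e < `|normG Gamma (betahat n w) - c|].
pose B n := [set w | K < `|norm2 (betahat n w)|].
(* The event [B n] has probability below [a / 2] by boundedness in probability. Outside it [betahat]
   lies in the box of radius [K], where a deviation larger than [e] would make its criterion exceed
   that of [beta0]; so [A n] minus [B n] gets the other [a / 2]. *)
have mAB n : measurable (A n `\` B n) by exact: measurableD (mA n) (mK n).
have /(whp_notP P mAB) : \forall z \near whp P, ~ (A z.1 `\` B z.1) z.2.
  have sep := whp_crit_separated_box cdfF hXs hYs XX YY K cdfY Yb hB0 e0.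
  apply: filterS2 dlse sep => z lez ltz /= [ez Kz].
  have /ltz/(_ ez) : forall i, `|tnth (betahat z.1 z.2) i| <= K.
    move=> i; apply: (le_trans (tnth_le_norm2 _ _)).
    by apply: (le_trans (ler_norm _)); rewrite leNgt; apply/negP.
  by rewrite ltNge lez.
move=> /fine_cvgP[_ /cvgrPdist_lt/(_ _ a2) AB0].
apply: filterS2 Kbeta AB0 => n /= Kn.
rewrite !sub0r !normrN !ger0_norm ?fine_ge0// => An.
rewrite -lte_fin fineK ?fin_num_measure//.
apply: (@le_lt_trans _ _ (P (A n `\` B n) + P (B n))%E).
  apply: le_trans; last by apply: measureU2 => //; exact: mK.
  apply: le_measure; rewrite ?inE//.
  - by apply: measurableU; [exact: mAB|exact: mK].
  - by move=> w Aw; case: (pselect (B n w)); [right|left].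
rewrite [ltRHS](_ : _ = (a / 2)%:E + (a / 2)%:E)%E; last by rewrite -EFinD -splitr.
by apply: lteD => //; move: An; rewrite -lte_fin fineK// fin_num_measure.
Qed.
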